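(* Every grounded L-graph with clique number $\omega$ has chromatic number at most $17\omega^4$.
   Context: Graphs are finite. An L-shape is a subset of $\mathbb{R}^2$ consisting of a vertical segment and a horizontal segment that meet at their uppermost and leftmost endpoints respectively (i.e. the topmost point of the vertical segment is the leftmost point of the horizontal segment, forming an upside-down ''L''). An L-shape is grounded if its lowermost point is on the $x$-axis. The intersection graph of a family of sets has the members of the family as vertices, two distinct members being adjacent if and only if they have non-empty intersection. A grounded L-graph is (a graph isomorphic to) the intersection graph of a finite family of grounded L-shapes. *)

(* Defs.v *)
From mathcomp Require Import all_boot all_order all_algebra.
From mathcomp Require Import boolp classical_sets reals.

Set Implicit Arguments.
Unset Strict Implicit.
Unset Printing Implicit Defensive.

Record sgraph := SGraph {
  vertex :> finType;
  edge : rel vertex;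
  edge_sym : symmetric edge;
  edge_irrefl : irreflexive edge }.

Definition isomorphic (G H : sgraph) : Prop :=
  exists2 f : G -> H, bijective f &
    forall x y : G, edge (f x) (f y) = edge x y.

Definition clique (G : sgraph) (K : {set G}) : bool :=
  [forall x in K, forall y in K, (x != y) ==> edge x y].

Definition clique_number (G : sgraph) : nat :=
  \max_(K : {set G} | clique K) #|K|.

Definition colorable (G : sgraph) (k : nat) : bool :=
  [exists c : {ffun G -> 'I_k},
    [forall x, forall y, edge x y ==> (c x != c y)]].

Lemma colorable_card (G : sgraph) : exists k, colorable G k.
Proof.
exists #|G|; apply/existsP; exists [ffun x => enum_rank x].
apply/forallP => x; apply/forallP => y; apply/implyP => exy.
rewrite !ffunE (inj_eq enum_rank_inj).
by apply: contraTneq exy => ->; rewrite edge_irrefl.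
Qed.

Definition chromatic_number (G : sgraph) : nat := ex_minn (colorable_card G).

Section IntersectionGraph.
Variables (T : Type) (I : finType) (F : I -> set T).
Local Open Scope classical_set_scope.

Definition meets : rel I := fun i j => (i != j) && `[< F i `&` F j !=set0 >].

Lemma meets_sym : symmetric meets.
Proof. by move=> i j; rewrite /meets eq_sym setIC. Qed.

Lemma meets_irrefl : irreflexive meets.
Proof. by move=> i; rewrite /meets eqxx. Qed.

(* The family is indexed: the vertices are the indices, so the same set may
   occur several times, its copies then being distinct vertices. *)
Definition intersection_graph : sgraph := SGraph meets_sym meets_irrefl.

End IntersectionGraph.

Section LShape.
Variable R : realType.
Local Open Scope classical_set_scope.
Local Open Scope ring_scope.

Definition vertical_segment (x y0 y1 : R) : set (R * R) :=
  [set p | p.1 = x /\ y0 <= p.2 <= y1].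

Definition horizontal_segment (x0 x1 y : R) : set (R * R) :=
  [set p | x0 <= p.1 <= x1 /\ p.2 = y].

(* The strict inequalities make both segments nondegenerate. *)
Definition L_shape (A : set (R * R)) : Prop :=
  exists x y0 x1 y1 : R, [/\ y0 < y1, x < x1 &
    A = vertical_segment x y0 y1 `|` horizontal_segment x x1 y1].

Definition lowermost (A : set (R * R)) (p : R * R) : Prop :=
  A p /\ forall q, A q -> p.2 <= q.2.

Definition grounded_L_shape (A : set (R * R)) : Prop :=
  L_shape A /\ exists2 p, lowermost A p & p.2 = 0.

Definition grounded_L_graph (G : sgraph) : Prop :=
  exists (I : finType) (F : I -> set (R * R)),
    (forall i, grounded_L_shape (F i)) /\ isomorphic G (intersection_graph F).

End LShape.

(* Main.v *)
Require Import Defs.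
From mathcomp Require Import all_boot all_order all_algebra.
From mathcomp Require Import boolp classical_sets reals.
From mathcomp Require Import zify.

Set Implicit Arguments.
Unset Strict Implicit.
Unset Printing Implicit Defensive.

(** Sort the L-shapes by their vertical segments and keep three ranks for each:
    the start [s] (position of the vertical segment), the finish [e] (last start
    within reach of the horizontal segment) and the height [h].  Then [u] and
    [v] with [s u < s v] meet exactly when [s v <= e u] and [h u <= h v]; this
    is the relation [adj].  The argument only uses these ranks and shows that
    [28 * w ^ 3] colours suffice when cliques have at most [w] elements, which
    is at most [17 * w ^ 4] as soon as [w >= 2]; for [w <= 1] there are no edges.

    A first factor [w] makes nested L-shapes disjoint.  The pairs with [v]
    nested in [u] and not lower than [u] form a strict order whose chains are
    cliques, so by Mirsky's theorem ([mirsky]) the family splits into [w]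
    classes, in each of which a nested L-shape is strictly lower.  Hence
    adjacent members of a class overlap: the later start has the later finish.

    A class is coloured by recursion on the segment of the ground line between
    two positions [a < b], the task being to colour the L-shapes strictly
    [inside], away from the colours already given outside ([extends]).  Choose a
    pillar between [a] and [b].  The inside L-shapes that pass over the pillar
    all get one fresh label, and one of [w] levels, again by Mirsky's theorem,
    to separate them from each other; this is the second factor [w].  The other
    ones lie on either side of the pillar and cause no conflict across it
    ([extends_cut]).  It remains to have a fresh label among [28 * w] labels at
    each step, so the outside neighbours of the segment must use few labels.

    The outside neighbours are of two kinds.  The left ones start before the
    segment and end in it; the right ones start in it and end after it.
    The invariant [grouped] says that either kind is partitioned into few
    groups of one label each, in an order such that two members of groups far
    enough apart are adjacent if they see parts of the segment in the
    corresponding left-to-right order.  When the segment is divided into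
    windows, few pairs of a window and a group seen from it can occur, as the
    pairs along each diagonal yield a clique and cliques are small
    ([staircase_count], [few_windows]).  Therefore, if windows are cut off
    greedily as soon as they see many groups, there are at most [6 * w] windows,
    and each of them sees fewer than [8 * w] old groups of each kind.  The
    pillars are the window ends, and the recursion goes into the windows
    ([grouped_window]).

    The windows are cut up to the last position [s wf] where an inside L-shape
    [wf] starts that meets a left neighbour [kf].  Nothing inside that starts
    later meets an old left neighbour.  As [kf] passes over all windows,
    everything inside a window is lower than [kf], hence lower than [wf], hence
    lower than every old right neighbour of the window.  This last fact is what
    keeps the right groups in order: the L-shapes over the new pillar, which
    form the new right group, are lower than the members of all but at most one
    of the old groups ([extends_from_windows], [extends_grouped]). *)

(** * Chains, staircases and windows *)

(** Mirsky's theorem: the height of an element, measured by the largest chain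
    below it, is a colouring that increases along [r]. *)
Lemma mirsky (T : finType) (r : rel T) (w : nat) :
    irreflexive r -> transitive r ->
    (forall A : {set T},
      {in A &, forall u v, u != v -> r u v || r v u} -> #|A| <= w) ->
  exists f : T -> nat,
    (forall v, f v < w) /\ (forall u v, r u v -> f u < f v).
Proof.
move=> irr tr bnd.
pose chain (A : {set T}) :=
  [forall u in A, forall v in A, (u != v) ==> r u v || r v u].
pose below v (A : {set T}) := chain A && [forall u in A, r u v].
pose f v := \max_(A : {set T} | below v A) #|A|.
have chainP (A : {set T}) : chain A ->
    {in A &, forall u v, u != v -> r u v || r v u}.
  move=> /forall_inP cA u v uA vA nuv.
  by move/forall_inP: (cA u uA) => /(_ v vA); rewrite nuv.
have ext v A : below v A -> v \notin A /\ chain (v |: A).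
  case/andP=> cA /forall_inP bA; split.
    by apply/negP => vA; move: (bA v vA); rewrite irr.
  apply/forall_inP => x; rewrite !inE => xA.
  apply/forall_inP => y; rewrite !inE => yA.
  apply/implyP => nxy; case/orP: xA => [/eqP xv | xA].
    case/orP: yA => [/eqP yv | yA]; first by rewrite xv yv eqxx in nxy.
    by rewrite xv (bA y yA) orbT.
  case/orP: yA => [/eqP yv | yA]; first by rewrite yv (bA x xA).
  exact: chainP cA _ _ xA yA nxy.
have max v : exists2 A, below v A & f v = #|A|.
  have b0 : below v finset.set0.
    by apply/andP; split; apply/forall_inP => x; rewrite finset.in_set0.
  have : 0 < #|below v| by apply/card_gt0P; exists finset.set0.
  by case/(eq_bigmax_cond (fun A : {set T} => #|A|)) => A bA fA; exists A.
exists f; split=> [v | u v ruv].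
  have [A bA ->] := max v; have [vA cA] := ext _ _ bA.
  by have := bnd _ (chainP _ cA); rewrite cardsU1 vA add1n.
have [A bA ->] := max u; have [uA cA] := ext _ _ bA.
suff bv : below v (u |: A).
  by apply: leq_trans (leq_bigmax_cond _ bv); rewrite cardsU1 uA add1n.
rewrite /below cA; apply/forall_inP => x; rewrite !inE.
case/orP=> [/eqP -> // | xA]; apply: tr ruv.
by case/andP: bA => _ /forall_inP; apply.
Qed.

(** A grid is covered by [N + M] diagonals, on which both coordinates increase
    together.  Splitting each diagonal by the residue of the second coordinate
    modulo [d.+1] makes the elements of a part differ there by more than [d],
    and the hypothesis bounds what lies in each of the [(N + M) * d.+1] parts. *)
Lemma staircase_count (N M w d : nat) (A : nat -> nat -> bool) :
    (forall D : {set 'I_N * 'I_M},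
      {in D, forall c : 'I_N * 'I_M, A c.1 c.2} ->
      {in D &, forall c c' : 'I_N * 'I_M, c != c' ->
         (c.1 < c'.1) && (c.2 + d < c'.2) ||
         (c'.1 < c.1) && (c'.2 + d < c.2)} ->
      #|D| <= w) ->
  \sum_(i < N) \sum_(g < M) A i g <= w * ((N + M) * d.+1).
Proof.
move=> bnd.
pose diag (c : 'I_N * 'I_M) := (c.1 + (M - c.2.+1)) * d.+1 + c.2 %% d.+1.
have diag_lt c : diag c < (N + M) * d.+1.
  case: c => i g; rewrite /diag /=.
  have := ltn_ord i; have := ltn_ord g; have := ltn_pmod g (ltn0Sn d).
  move: (g %% _) => x; nia.
pose X := [set c : 'I_N * 'I_M | A c.1 c.2].
have -> : \sum_(i < N) \sum_(g < M) A i g = #|X|.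
  rewrite pair_big /= -sum1dep_card [RHS]big_mkcond /=.
  by apply: eq_bigr => c _; case: (A _ _).
rewrite -sum1_card (partition_big (fun c => Ordinal (diag_lt c)) predT) //=.
have -> : w * ((N + M) * d.+1) = \sum_(q < (N + M) * d.+1) w.
  by rewrite sum_nat_const card_ord mulnC.
apply: leq_sum => q _.
have -> : \sum_(c in X | Ordinal (diag_lt c) == q) 1 =
          #|[set c in X | diag c == q]|.
  by rewrite -sum1dep_card; apply: eq_bigl => c.
apply: bnd => [c | c c']; first by rewrite !inE => /andP[].
rewrite !inE => /andP[_ /eqP dc] /andP[_ /eqP dc'] ncc'.
have : diag c = diag c' by rewrite dc dc'.
case: c c' ncc' {dc dc'} => [i g] [i' g'] /= ncc'; rewrite /diag /= => dd.
have ed : i + (M - g.+1) = i' + (M - g'.+1).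
  have := congr1 (divn^~ d.+1) dd.
  by rewrite !divnMDl // !divn_small ?ltn_pmod // !addn0.
have em : g %% d.+1 = g' %% d.+1 by move: dd; rewrite ed => /addnI.
have nii : i != i' :> nat.
  apply: contraNneq ncc' => ii; apply/eqP; congr (_, _); apply: val_inj => //=.
  have := ltn_ord g; have := ltn_ord g'; lia.
have step x y : x < y -> x %% d.+1 = y %% d.+1 -> x + d < y.
  move=> xy exy; have := divn_eq x d.+1; have := divn_eq y d.+1; rewrite -exy.
  move: (x %/ _) (y %/ _) (x %% _) => X1 Y1 Z1 ey ex.
  have : X1 < Y1 by rewrite ltnNge; apply/negP => ?; nia.
  nia.
have := ltn_ord g; have := ltn_ord g' => g'M gM.
have [lt|gt|/eqP] := ltngtP (i : nat) (i' : nat); last by rewrite (negPf nii).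
  by rewrite (step _ _ _ em) ?orbT //=; lia.
by rewrite (step _ _ _ (esym em)) ?orbT //=; lia.
Qed.

(** Used to renumber the groups that a window still sees, keeping their order. *)
Definition rank_in (A : nat -> bool) (g : nat) : nat := \sum_(0 <= k < g) A k.

Lemma rank_in_diff (A : nat -> bool) g g' : g <= g' ->
  rank_in A g <= rank_in A g' <= rank_in A g + (g' - g).
Proof.
move=> gg'; rewrite /rank_in (big_cat_nat (leq0n g) gg') /= leq_addr leq_add2l.
apply: leq_trans (_ : \sum_(g <= k < g') 1 <= _).
  by apply: leq_sum => k _; case: (A k).
by rewrite sum_nat_const_nat muln1.
Qed.

Lemma rank_in_lt (A : nat -> bool) g g' : A g -> g < g' -> rank_in A g < rank_in A g'.
Proof.
move=> Ag gg'; have /andP[+ _] := rank_in_diff A gg'.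
by rewrite {1}/rank_in big_nat_recr //= Ag addn1.
Qed.

Lemma rank_in_ord (A : nat -> bool) m : rank_in A m = \sum_(g < m) A g.
Proof. by rewrite /rank_in big_mkord. Qed.

(** [code] numbers the groups of elements that share a label [c]: fewer groups
    than labels leave a label free. *)
Lemma fresh_label (T : finType) (P : pred T) (code c : T -> nat) (m L : nat) :
    m < L -> (forall v, P v -> code v < m) ->
    (forall u v, P u -> P v -> code u = code v -> c u = c v) ->
  exists2 l, l < L & forall v, P v -> c v <> l.
Proof.
move=> mL cm cc.
case: (boolP [exists l : 'I_L, [forall v, P v ==> (c v != l)]]).
  case/existsP=> l /forallP Pl; exists l => [|v Pv]; [exact: ltn_ord | apply/eqP].
  by have := Pl v; rewrite Pv.
rewrite negb_exists => /forallP ex.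
have [f fP] : exists f : 'I_L -> T, forall l, P (f l) /\ c (f l) = l.
  apply: (fin_all_exists (P := fun (l : 'I_L) v => P v /\ c v = l)) => l.
  move: (ex l); rewrite negb_forall => /existsP[v].
  by rewrite negb_imply negbK => /andP[Pv /eqP cv]; exists v.
have ltm l : code (f l) < m by apply: cm; case: (fP l).
suff /leq_card : injective (fun l => Ordinal (ltm l)) by rewrite !card_ord; lia.
move=> l l' /(congr1 val) /= ell; apply: val_inj => /=.
have [Pl <-] := fP l; have [Pl' <-] := fP l'; exact: cc.
Qed.

(** Each window ends at the first position that makes it overflow; only the
    last one, which ends at [P], may not overflow. *)
Lemma greedy_windows (over : nat -> nat -> bool) (a P : nat) : a < P ->
  exists n (p : nat -> nat),
    [/\ p 0 = a /\ p n = P,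
        forall i, i < n -> p i < p i.+1,
        forall i q, i < n -> p i < q -> q < p i.+1 -> ~~ over (p i) q &
        forall i, i.+1 < n -> over (p i) (p i.+1)].
Proof.
have [k] := ubnP (P - a); elim: k a => // k IH a lek aP.
case: (boolP [exists q : 'I_P, (a < q) && over a q]); last first.
  rewrite negb_exists => /forallP no; exists 1, (fun i => if i is 0 then a else P).
  split=> // -[|i] // q _ aq qP.
  by move: (no (Ordinal qP)); rewrite aq.
case/existsP=> q0 oq0.
have ex : exists q, [&& a < q, q < P & over a q].
  by exists q0; rewrite ltn_ord /= .
case: (ex_minnP ex) => q /and3P[aq qP oq] minq.
have [n [p [[p0 pn] inc no ov]]] := IH q ltac:(lia) qP.
exists n.+1, (fun i => if i is j.+1 then p j else a); split => //.
- by case=> [|i] /= lt; [rewrite p0 | apply: inc].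
- case=> [|i] x /= lt; last exact: no.
  rewrite p0 => ax xq; apply/negP => ox.
  by have := minq x; rewrite ax ox (ltn_trans xq qP) => /(_ isT); lia.
- case=> [|i] /= lt; [by rewrite p0 | exact: ov].
Qed.

Lemma increasing_leq n (p : nat -> nat) i j :
  (forall k, k < n -> p k < p k.+1) -> i <= j -> j <= n -> p i <= p j.
Proof.
move=> inc ij; elim: j ij => [|j IH]; first by case: i.
rewrite leq_eqVlt => /orP[/eqP -> // | ij] jn.
by apply: leq_trans (IH _ _) (ltnW (inc _ jn)); lia.
Qed.

(** Two pillars delimit a window; elements that start in the same window get
    their label from the same pillar, so this index serves as group number. *)
Definition window_index (p : nat -> nat) n x := find (fun i => x <= p i) (iota 0 n).

Lemma window_index_leq p n x i : i <= n -> x <= p i -> window_index p n x <= i.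
Proof.
rewrite leq_eqVlt => /orP[/eqP -> _|iN xi].
  by rewrite -[X in _ <= X](size_iota 0 n) find_size.
rewrite leqNgt; apply/negP => /(before_find 0).
by rewrite nth_iota // add0n xi.
Qed.

Lemma window_index_gt p n x i :
  (forall j, j <= i -> p j <= p i) -> i < n -> p i < x -> i < window_index p n x.
Proof.
move=> mono iN pix; rewrite ltnNge; apply/negP => fi.
have fn : window_index p n x < n by lia.
have : has (fun i => x <= p i) (iota 0 n) by rewrite has_find size_iota.
move/(nth_find 0); rewrite nth_iota // add0n -/(window_index p n x).
by have := mono _ fi; lia.
Qed.

Lemma window_index_mono p n x y : x <= y -> window_index p n x <= window_index p n y.
Proof.
move=> xy; rewrite {2}/window_index.
have [hs|] := boolP (has (fun i => y <= p i) (iota 0 n)).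
  have := hs; rewrite has_find size_iota => lt.
  apply: window_index_leq; first exact: ltnW.
  by have := nth_find 0 hs; rewrite nth_iota // add0n; lia.
by move/hasNfind => ->; exact: find_size.
Qed.

(** With [6 * w] windows, [14 * w - 1] left groups and [8 * w] right groups the
    diagonals allow strictly fewer than [8 * w] seen groups per window on
    average.  The other constraints on these constants are that the left groups
    of a window are its [8 * w - 1] old ones and one for each window, and that
    its right groups are its [8 * w - 1] old ones and one new one. *)
Lemma window_budget w x y : 0 < w ->
  x <= w * ((6 * w + (14 * w - 1)) * 1) -> y <= w * ((6 * w + 8 * w) * 2) ->
  6 * w * (8 * w) <= x + y -> False.
Proof.
case: w => // k _; have -> : 14 * k.+1 - 1 = 14 * k + 13 by lia.
nia.
Qed.

(** * Colouring the L-shapes inside a segment *)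

Section Segments.
Variables (T : finType) (s e h : T -> nat) (w : nat).

Definition adj (u v : T) := [&& s u < s v, s v <= e u & h u <= h v].

Definition clique_bound := forall A : {set T},
  {in A &, forall u v, u != v -> adj u v || adj v u} -> #|A| <= w.

(** As no start exceeds the finish, this says that nested elements are never
    adjacent. *)
Definition nested_lower := forall u v, s u < s v -> e v <= e u -> h v < h u.

Definition inside a b v := (a < s v) && (e v < b).

Definition left_neighbor a b v :=
  (s v <= a) && [exists u, inside a b u && adj v u].

Definition right_neighbor a b v :=
  (b <= e v) && [exists u, inside a b u && adj u v].

(** Let [u] be in a left group of smaller number than that of [v].  If [u] meets
    something in the segment that lies, as a whole, left of something that [v]
    meets, then [u] and [v] are adjacent: [u] starts first, and [v] is higher
    than [u], as it passes over what [u] meets there, which is thus nested in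
    it and lower. *)
Definition left_groups a b (c : T -> nat) m (g : T -> nat) :=
  [/\ forall v, left_neighbor a b v -> g v < m,
      forall u v, left_neighbor a b u -> left_neighbor a b v -> g u < g v -> s u < s v
    & forall u v, left_neighbor a b u -> left_neighbor a b v -> g u = g v -> c u = c v].

(** Right groups are numbered from the newest, whose members cross the latest
    pillar on the right.  Only pairs of groups at distance at least two are
    under control, because the newest group lies below all others except
    possibly the next one; the last clause is what proves that. *)
Definition right_groups a b (c : T -> nat) m (g : T -> nat) :=
  [/\ forall v, right_neighbor a b v -> g v < m,
      forall u v, right_neighbor a b u -> right_neighbor a b v -> g u = g v -> c u = c v,
      forall u v, right_neighbor a b u -> right_neighbor a b v ->
        s u < s v -> (g u).+1 < g v -> h u <= h v
    & forall u v, inside a b u -> right_neighbor a b v -> 0 < g v -> h u < h v].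

Definition grouped a b c := exists gl gr,
  left_groups a b c (14 * w - 1) gl /\ right_groups a b c (8 * w) gr.

(** [lab] is the part of the colour that outside elements also have to avoid;
    [lev] only separates inside elements with the same label. *)
Definition extends a b (c : T -> nat) := exists lab lev : T -> nat,
  [/\ forall v, inside a b v -> (lab v < 28 * w) && (lev v < w),
      forall u v, inside a b u -> inside a b v -> adj u v ->
        (lab u, lev u) <> (lab v, lev v)
    & forall u v, inside a b u -> ~~ inside a b v -> adj u v || adj v u ->
        lab u <> c v].

Definition through a b p v := inside a b v && (s v <= p <= e v).

Definition recolor a b p l (c : T -> nat) v := if through a b p v then l else c v.

Hypothesis s_le_e : forall v, s v <= e v.
Hypothesis nested : nested_lower.
Hypothesis cb : clique_bound.
Hypothesis w_gt0 : 0 < w.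

(** Elements that pass over the same position overlap, so there adjacency is
    the strict order given by start and height, and its chains are cliques. *)
Lemma pillar_levels p :
  exists lev : T -> nat, (forall v, lev v < w) /\
    (forall u v, adj u v -> s v <= p -> p <= e u -> p <= e v -> lev u < lev v).
Proof.
have [] := @mirsky T
  (fun u v => [&& s u < s v, h u <= h v, s v <= p, p <= e u & p <= e v]) w.
- by move=> v; rewrite ltnn.
- move=> v u x /and5P[? ? ? ? ?] /and5P[? ? ? ? ?]; apply/and5P; split=> //; lia.
- move=> A cA; apply: cb => u v uA vA nuv; rewrite /adj.
  by case/orP: (cA u v uA vA nuv) => /and5P[? ? ? ? ?]; apply/orP; [left|right];
     apply/and3P; split=> //; lia.
move=> lev [lt inc]; exists lev; split=> // u v /and3P[? ? ?] ? ? ?.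
by apply: inc; apply/and5P.
Qed.

Lemma adj_finish u v : adj u v -> e u < e v.
Proof.
case/and3P=> suv _ huv; rewrite ltnNge; apply/negP => /(nested suv).
by rewrite ltnNge huv.
Qed.

Lemma adj_left_neighbor a b u v :
  inside a b u -> ~~ inside a b v -> adj v u -> left_neighbor a b v.
Proof.
move=> iu nv vu; rewrite /left_neighbor; apply/andP; split.
  have := adj_finish vu; move: iu nv; rewrite /inside.
  by case/andP=> *; lia.
by apply/existsP; exists u; rewrite iu.
Qed.

Lemma adj_right_neighbor a b u v :
  inside a b u -> ~~ inside a b v -> adj u v -> right_neighbor a b v.
Proof.
move=> iu nv uv; rewrite /right_neighbor; apply/andP; split.
  by case/and3P: uv iu nv; rewrite /inside => ? ? ? /andP[? ?]; lia.
by apply/existsP; exists u; rewrite iu.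
Qed.

Lemma extends_empty a b c : (forall v, ~~ inside a b v) -> extends a b c.
Proof.
move=> no; exists (fun=> 0), (fun=> 0); split=> u.
- by rewrite (negPf (no u)).
- by move=> v; rewrite (negPf (no u)).
- by move=> v; rewrite (negPf (no u)).
Qed.

(** Elements on different sides of the pillar [p] are not adjacent.  For either
    side those over the pillar are outside elements, avoided because they have
    been recoloured; among themselves they are separated by the levels, and the
    fresh label [l] keeps them apart from the outside of the whole segment. *)
Lemma extends_cut a b p l c : a < p -> p < b -> l < 28 * w ->
    (forall v, left_neighbor a b v || right_neighbor a b v -> c v <> l) ->
    extends a p (recolor a b p l c) -> extends p b (recolor a b p l c) ->
  extends a b c.
Proof.
move=> ap pb lL fresh [lab1 [lev1 [lt1 pr1 out1]]] [lab2 [lev2 [lt2 pr2 out2]]].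
have [lev [levw levP]] := pillar_levels p.
pose lab v := if inside a p v then lab1 v else if inside p b v then lab2 v else l.
pose lev' v := if inside a p v then lev1 v else if inside p b v then lev2 v else lev v.
have cases v : inside a b v ->
    [\/ inside a p v /\ ~~ inside p b v, inside p b v /\ ~~ inside a p v
      | [/\ ~~ inside a p v, ~~ inside p b v & through a b p v]].
  rewrite /through /inside; have := s_le_e v => ? /andP[? ?].
  case: (ltnP (e v) p) => ?; first by constructor 1; lia.
  case: (ltnP p (s v)) => ?; first by constructor 2; lia.
  by constructor 3; split; lia.
have sub v : inside a p v || inside p b v -> inside a b v.
  by rewrite /inside => /orP[] /andP[? ?]; have := s_le_e v; lia.
have out_rel u v : inside a b u -> ~~ inside a b v -> adj u v || adj v u ->
    left_neighbor a b v || right_neighbor a b v.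
  move=> iu nv /orP[uv|vu]; first by rewrite (adj_right_neighbor iu nv uv) orbT.
  by rewrite (adj_left_neighbor iu nv vu).
have recE v : ~~ inside a b v -> recolor a b p l c v = c v.
  by rewrite /recolor /through => /negPf ->.
exists lab, lev'; split.
- move=> v iv; rewrite /lab /lev'.
  case: (cases v iv) => [[i1 n2] | [i2 n1] | [n1 n2 _]].
  + by rewrite i1; apply: lt1.
  + by rewrite (negPf n1) i2; apply: lt2.
  + by rewrite (negPf n1) (negPf n2) lL levw.
- have mix u v : inside a b u -> inside a b v -> adj u v || adj v u ->
      inside a p u -> ~~ inside a p v -> lab u <> lab v.
    move=> iu iv uv iu1 nv1; case: (cases v iv) => [[]| [iv2 _] |[_ nv2 tv]].
    + by rewrite (negPf nv1).
    + by case/orP: uv => /and3P[? ? ?]; move: iu1 iv2 (s_le_e u); rewrite /inside; lia.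
    + by have := out1 u v iu1 nv1 uv; rewrite /recolor tv /lab iu1 (negPf nv1) (negPf nv2).
  have mix2 u v : inside a b u -> inside a b v -> adj u v || adj v u ->
      inside p b u -> ~~ inside p b v -> lab u <> lab v.
    move=> iu iv uv iu2 nv2; case: (cases v iv) => [[iv1 _]| [iv2 _] |[nv1 _ tv]].
    + by case/orP: uv => /and3P[? ? ?]; move: iu2 iv1 (s_le_e v); rewrite /inside; lia.
    + by rewrite iv2 in nv2.
    + have := out2 u v iu2 nv2 uv; rewrite /recolor tv /lab iu2 (negPf nv1) (negPf nv2).
      by case: (cases u iu) => [[_]|[_ nu1]|[_]]; rewrite ?iu2 // (negPf nu1).
  move=> u v iu iv uv.
  have uv' : adj u v || adj v u by rewrite uv.
  have vu' : adj v u || adj u v by rewrite uv orbT.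
  case: (cases u iu) => [[u1 nu2] | [u2 nu1] | [nu1 nu2 tu]];
  case: (cases v iv) => [[v1 nv2] | [v2 nv1] | [nv1 nv2 tv]];
  try by case; move=> E _; first [ exact: (mix u v) E | exact: (mix v u) (esym E)
      | exact: (mix2 u v) E | exact: (mix2 v u) (esym E) ].
  + by rewrite /lab /lev' u1 v1; apply: pr1.
  + by rewrite /lab /lev' (negPf nu1) (negPf nv1) u2 v2; apply: pr2.
  + rewrite /lab /lev' (negPf nu1) (negPf nv1) (negPf nu2) (negPf nv2) => -[E].
    case/and3P: tu tv => _ ? ? /and3P[_ ? ?].
    by have := levP u v uv; rewrite E; lia.
- move=> u v iu nv uv; rewrite -(recE v nv) /lab.
  have nv1 : ~~ inside a p v by apply: contra nv => ?; apply: sub; lia.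
  have nv2 : ~~ inside p b v by apply: contra nv => ?; apply: sub; lia.
  case: (cases u iu) => [[u1 nu2] | [u2 nu1] | [nu1 nu2 tu]].
  + by rewrite u1; apply: out1.
  + by rewrite (negPf nu1) u2; apply: out2.
  + rewrite (negPf nu1) (negPf nu2) recE // => /esym.
    by apply: fresh; apply: out_rel uv.
Qed.

(** * Counting the groups seen from windows *)

Lemma representatives_clique (I : finType) (D : {set I}) (P : I -> T -> Prop) :
    (forall c, c \in D -> exists v, P c v) ->
    (forall c c' u v, c \in D -> c' \in D -> c != c' -> P c u -> P c' v ->
       adj u v || adj v u) ->
  #|D| <= w.
Proof.
move=> ex cl.
have [f fP] : exists f : {c | c \in D} -> T, forall c, P (val c) (f c).
  apply: (fin_all_exists (P := fun (c : {c | c \in D}) v => P (val c) v)) => c.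
  exact: ex (valP c).
have adjf c c' : c != c' -> adj (f c) (f c') || adj (f c') (f c).
  by move=> ncc'; apply: (cl (val c) (val c')) (fP _) (fP _);
     rewrite ?(inj_eq val_inj) ?(valP c) ?(valP c').
have injf : injective f.
  move=> c c' ff; apply/eqP/negPn/negP => /adjf.
  by rewrite ff /adj ltnn.
have := cb (A := [set f c | c : {c | c \in D}]).
rewrite card_imset // card_sig; apply => _ _ /imsetP[c _ ->] /imsetP[c' _ ->] nff.
by apply: adjf; apply: contraNneq nff => ->.
Qed.

Definition left_seen a (g : T -> nat) q p (i : nat) :=
  [exists v, exists u, [&& s v <= a, adj v u, q < s u, e u < p & g v == i]].

Definition right_seen b (g : T -> nat) q p (i : nat) :=
  [exists v, exists u, [&& b <= e v, adj u v, q < s u, e u < p & g v == i]].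

(** Let [v] see [u] in one window and [v'] see [u'] in a later one, with the
    group of [v'] above that of [v].  Then [u] is nested in [v'], since [v']
    starts before the segment and reaches [u'].  So [v] is not higher than
    [u], which is lower than [v'], and [v] starts first: they are adjacent.
    Hence the pairs along a diagonal yield a clique. *)
Lemma left_seen_count a b c m g N p :
    left_groups a b c m g -> a <= p 0 -> p N < b ->
    (forall i, i < N -> p i < p i.+1) ->
  \sum_(i < N) \sum_(k < m) left_seen a g (p i) (p i.+1).+1 k <= w * ((N + m) * 1).
Proof.
move=> [gm gs _] ap pb inc.
have mono i j := @increasing_leq N p i j inc.
apply: (@staircase_count N m w 0
  (fun i k => left_seen a g (p i) (p i.+1).+1 k)) => D seenD chainD.
apply: (@representatives_clique ('I_N * 'I_m)%type D (fun c v => exists u,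
   [&& s v <= a, adj v u, p c.1 < s u, e u < (p c.1.+1).+1 & g v == c.2])).
  by move=> c' /seenD /existsP[v /existsP[u ?]]; exists v, u.
suff sym x y v v' : x \in D -> y \in D -> (x.1 < y.1) && (x.2 + 0 < y.2) ->
    (exists u, [&& s v <= a, adj v u, p x.1 < s u, e u < (p x.1.+1).+1 & g v == x.2]) ->
    (exists u, [&& s v' <= a, adj v' u, p y.1 < s u, e u < (p y.1.+1).+1 & g v' == y.2]) ->
    adj v v'.
  move=> x y v v' xD yD nxy Pv Pv'.
  by case/orP: (chainD x y xD yD nxy) => lt; apply/orP; [left|right];
     [exact: sym xD yD lt Pv Pv' | exact: sym yD xD lt Pv' Pv].
have rel u z q r j : [&& s z <= a, adj z u, p q < s u, e u < r & j] ->
    q < N -> r <= b -> left_neighbor a b z.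
  case/and5P=> va vu qu ur _ qN rb; rewrite /left_neighbor va; apply/existsP; exists u.
  rewrite vu andbT /inside; have := mono 0 q isT (ltnW qN); lia.
move=> xD yD /andP[lt1 lt2] [u Hu] [u' Hu'].
have [xN yN] : x.1 < N /\ y.1 < N by split; apply: ltn_ord.
have pxb i : i < N -> (p i.+1).+1 <= b by move=> iN; have := mono i.+1 N iN (leqnn N); lia.
have lv := rel _ _ _ _ _ Hu xN (pxb _ xN).
have lv' := rel _ _ _ _ _ Hu' yN (pxb _ yN).
case/and5P: Hu => va vu qu ur /eqP gv; case/and5P: Hu' => va' vu' qu' ur' /eqP gv'.
have svv : s v < s v' by apply: gs; rewrite // gv gv'; lia.
have p01 := mono 0 x.1 isT (ltnW xN).
have p12 := mono x.1.+1 y.1 lt1 (ltnW yN).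
have huv' : h u < h v'.
  by apply: nested; [lia | case/and3P: vu' => *; lia].
by case/and3P: vu => ? ? ?; apply/and3P; split; lia.
Qed.

(** Let [u] see [v] from one window and [u'] see [v'] from a later one.  Then
    [v] starts before the end of the first window and [v'] after [u'], and [v]
    reaches beyond the segment, so only the heights matter for adjacency; the
    order of the right groups settles them for groups at distance two.  This
    distance is the reason for splitting the diagonals by parity. *)
Lemma right_seen_count a b c m g N p :
    right_groups a b c m g -> a <= p 0 -> p N < b ->
    (forall i, i < N -> p i < p i.+1) ->
  \sum_(i < N) \sum_(k < m) right_seen b g (p i) (p i.+1).+1 k <= w * ((N + m) * 2).
Proof.
move=> [gm _ gh _] ap pb inc.
have mono i j := @increasing_leq N p i j inc.
apply: (@staircase_count N m w 1
  (fun i k => right_seen b g (p i) (p i.+1).+1 k)) => D seenD chainD.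
apply: (@representatives_clique ('I_N * 'I_m)%type D (fun c v => exists u,
   [&& b <= e v, adj u v, p c.1 < s u, e u < (p c.1.+1).+1 & g v == c.2])).
  by move=> c' /seenD /existsP[v /existsP[u ?]]; exists v, u.
suff sym x y v v' : x \in D -> y \in D -> (x.1 < y.1) && (x.2 + 1 < y.2) ->
    (exists u, [&& b <= e v, adj u v, p x.1 < s u, e u < (p x.1.+1).+1 & g v == x.2]) ->
    (exists u, [&& b <= e v', adj u v', p y.1 < s u, e u < (p y.1.+1).+1 & g v' == y.2]) ->
    adj v v'.
  move=> x y v v' xD yD nxy Pv Pv'.
  by case/orP: (chainD x y xD yD nxy) => lt; apply/orP; [left|right];
     [exact: sym xD yD lt Pv Pv' | exact: sym yD xD lt Pv' Pv].
have rel u z q r j : [&& b <= e z, adj u z, p q < s u, e u < r & j] ->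
    q < N -> r <= b -> right_neighbor a b z.
  case/and5P=> va vu qu ur _ qN rb; rewrite /right_neighbor va; apply/existsP; exists u.
  rewrite vu andbT /inside; have := mono 0 q isT (ltnW qN); lia.
move=> xD yD /andP[lt1 lt2] [u Hu] [u' Hu'].
have [xN yN] : x.1 < N /\ y.1 < N by split; apply: ltn_ord.
have pxb i : i < N -> (p i.+1).+1 <= b by move=> iN; have := mono i.+1 N iN (leqnn N); lia.
have lv := rel _ _ _ _ _ Hu xN (pxb _ xN).
have lv' := rel _ _ _ _ _ Hu' yN (pxb _ yN).
have p12 := mono x.1.+1 y.1 lt1 (ltnW yN).
case/and5P: Hu => va vu qu ur /eqP gv; case/and5P: Hu' => va' vu' qu' ur' /eqP gv'.
case/and3P: vu => ? ? ?; case/and3P: vu' => ? ? ?.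
have := pxb _ yN => ?.
have := s_le_e u' => ?.
have svv : s v < s v' by lia.
by apply/and3P; split; [lia | lia | apply: gh; rewrite // gv gv'; lia].
Qed.

Lemma few_windows a b c gl gr p :
    left_groups a b c (14 * w - 1) gl -> right_groups a b c (8 * w) gr ->
    a <= p 0 -> p (6 * w) < b -> (forall i, i < 6 * w -> p i < p i.+1) ->
  exists2 i, i < 6 * w &
    (\sum_(k < 14 * w - 1) left_seen a gl (p i) (p i.+1).+1 k < 8 * w) &&
    (\sum_(k < 8 * w) right_seen b gr (p i) (p i.+1).+1 k < 8 * w).
Proof.
move=> lg rg ap pb inc.
have lc := left_seen_count lg ap pb inc; have rc := right_seen_count rg ap pb inc.
set A := fun i => \sum_(k < 14 * w - 1) left_seen a gl (p i) (p i.+1).+1 k.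
set B := fun i => \sum_(k < 8 * w) right_seen b gr (p i) (p i.+1).+1 k.
case: (boolP [exists i : 'I_(6 * w), (A i < 8 * w) && (B i < 8 * w)]).
  by case/existsP=> i; exists i.
rewrite negb_exists => /forallP big; exfalso.
have : \sum_(i < 6 * w) 8 * w <= \sum_(i < 6 * w) (A i + B i).
  by apply: leq_sum => i _; have := big i; lia.
rewrite sum_nat_const card_ord big_split; exact: window_budget w_gt0 lc rc.
Qed.

Lemma groups_fresh_label a b c ml mr gl gr L : ml + mr < L ->
    left_groups a b c ml gl -> right_groups a b c mr gr ->
  exists2 l, l < L & forall v, left_neighbor a b v || right_neighbor a b v -> c v <> l.
Proof.
move=> mL [lm _ lc] [rm rc _ _].
apply: (@fresh_label T (fun v => left_neighbor a b v || right_neighbor a b v)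
  (fun v => if left_neighbor a b v then gl v else ml + gr v) c _ _ mL).
- by move=> v; case: ifP => [/lm|_ /rm] /=; lia.
- move=> u v; case: ifP => lu; case: ifP => lv /= ru rv.
  + exact: lc.
  + by have := lm _ lu; lia.
  + by have := lm _ lv; lia.
  + by move/addnI; apply: rc.
Qed.
Lemma left_neighborP a b v :
  reflect (exists u, [/\ s v <= a, inside a b u & adj v u]) (left_neighbor a b v).
Proof.
apply: (iffP andP) => [[va /existsP[u /andP[iu vu]]] | [u [va iu vu]]]; first by exists u.
by split=> //; apply/existsP; exists u; rewrite iu.
Qed.

Lemma right_neighborP a b v :
  reflect (exists u, [/\ b <= e v, inside a b u & adj u v]) (right_neighbor a b v).
Proof.
apply: (iffP andP) => [[va /existsP[u /andP[iu vu]]] | [u [va iu vu]]]; first by exists u.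
by split=> //; apply/existsP; exists u; rewrite iu.
Qed.

(** * The recursion *)

(** The groups of the window from [q] to [p], the old ones being those of the
    segment from [a] to [b].  The left neighbours are old ones, renumbered by
    rank among those the window sees, followed by those that start in an
    earlier window, grouped by that window.  The right neighbours
    are the elements over the pillar [p], all labelled [l], as group [0],
    followed by the old ones, again renumbered. *)
Lemma grouped_window a b q p c c' gl gr ix n l :
    left_groups a b c (14 * w - 1) gl -> right_groups a b c (8 * w) gr ->
    a <= q -> q < p ->
    (exists v u, [/\ s v <= a, inside a b u, adj v u & p <= s u]) ->
    \sum_(k < 14 * w - 1) left_seen a gl q p k < 8 * w ->
    \sum_(k < 8 * w) right_seen b gr q p k < 8 * w ->
    (forall v, ~~ inside a b v -> c' v = c v) ->
    (forall v, s v <= q -> ix v < n) -> n <= 6 * w ->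
    (forall u v, s u <= s v -> ix u <= ix v) ->
    (forall u v, a < s u -> a < s v -> left_neighbor q b u -> left_neighbor q b v ->
       ix u = ix v -> c' u = c' v) ->
  grouped q p (recolor q b p l c').
Proof.
move=> [glm gls glc] [grm grc grh grf] aq qp [kf [wf [ka iw kw pw]]] nL nR
  agree ixn n6 ixmono ixc.
have pb : p < b by case/andP: iw => ?; have := s_le_e wf; lia.
have sub u : inside q p u -> inside a b u by rewrite /inside; lia.
have subq u : inside q p u -> inside q b u by rewrite /inside; lia.
pose AL := left_seen a gl q p.
pose AR := right_seen b gr q p.
have lseen v : left_neighbor q p v -> s v <= a -> AL (gl v) /\ left_neighbor a b v.
  case/left_neighborP=> u [vq iu vu] va; split; last by apply/left_neighborP; exists u; split; auto.
  apply/existsP; exists v; apply/existsP; exists u.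
  by case/andP: iu => -> ->; rewrite va vu eqxx.
have rseen v : right_neighbor q p v -> b <= e v -> AR (gr v) /\ right_neighbor a b v.
  case/right_neighborP=> u [vq iu uv] vb; split; last by apply/right_neighborP; exists u; split; auto.
  apply/existsP; exists v; apply/existsP; exists u.
  by case/andP: iu => -> ->; rewrite vb uv eqxx.
have lq v : left_neighbor q p v -> left_neighbor q b v.
  by case/left_neighborP=> u [vq iu vu]; apply/left_neighborP; exists u; split; auto.
have rank_in_inj (A : nat -> bool) x y :
    A x -> A y -> rank_in A x = rank_in A y -> x = y.
  move=> Ax Ay E; case: (ltngtP x y) => // lt.
    by have := rank_in_lt Ax lt; rewrite E ltnn.
  by have := rank_in_lt Ay lt; rewrite E ltnn.
have nL' : rank_in AL (14 * w - 1) < 8 * w by rewrite rank_in_ord.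
have nR' : rank_in AR (8 * w) < 8 * w by rewrite rank_in_ord.
have rkL v : left_neighbor q p v -> s v <= a -> rank_in AL (gl v) < 8 * w - 1.
  move=> lv va; have [Av lab] := lseen v lv va.
  by have := rank_in_lt Av (glm v lab); lia.
have rkR v : right_neighbor q p v -> b <= e v -> rank_in AR (gr v) < 8 * w - 1.
  move=> lv va; have [Av lab] := rseen v lv va.
  by have := rank_in_lt Av (grm v lab); lia.
have left_keep v : left_neighbor q p v -> recolor q b p l c' v = c' v.
  by case/left_neighborP=> u [vq _ _]; rewrite /recolor /through /inside ltnNge vq.
have right_keep v : b <= e v -> recolor q b p l c' v = c v.
  move=> bv; rewrite /recolor /through /inside [e v < b]ltnNge bv andbF /=.
  by apply: agree; rewrite /inside [e v < b]ltnNge bv andbF.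
have right_new v : right_neighbor q p v -> ~~ (b <= e v) ->
    recolor q b p l c' v = l /\ inside a b v.
  case/right_neighborP=> u [pv iu /and3P[uv vu _]]; rewrite -ltnNge => bv.
  rewrite /recolor /through /inside.
  case/andP: iu => qu up.
  by rewrite bv (ltn_trans qu uv) pv (leq_trans vu (ltnW up)) /=; split=> //; lia.
pose gl' v := if s v <= a then rank_in AL (gl v) else (8 * w - 1) + ix v.
pose gr' v := if b <= e v then (rank_in AR (gr v)).+1 else 0.
(* [kf] passes over the window and is not higher than [wf], which in turn is
   nested in every old right neighbour of the window. *)
have floor u v : inside q p u -> right_neighbor q p v -> b <= e v -> h u < h v.
  move=> iu rv bv; case/and3P: kw => kw1 kw2 kw3.
  have hk : h u < h kf.
    by case/andP: iu => ? ?; apply: nested; lia.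
  suff : h wf < h v by lia.
  case/right_neighborP: rv => x [_ ix' /and3P[xv vx _]]; case/andP: ix' => ? ?.
  by case/andP: iw => ? ?; apply: nested; lia.
exists gl', gr'; split; split.
- move=> v lv; rewrite /gl'; case: ifP => va; first by have := rkL v lv va; lia.
  by case/left_neighborP: lv => u [vq _ _]; have := ixn v vq; lia.
- move=> u v lu lv; rewrite /gl'; case: ifP => ua; case: ifP => va; try lia.
  + move=> lt; have [_ lu'] := lseen u lu ua; have [_ lv'] := lseen v lv va.
    apply: gls => //; rewrite ltnNge; apply/negP => le.
    by have /andP[+ _] := rank_in_diff AL le; lia.
  + by have := rkL v lv va; lia.
  + move=> lt; rewrite ltnNge; apply/negP => /ixmono; lia.
- move=> u v lu lv; rewrite !left_keep // /gl'; case: ifP => ua; case: ifP => va.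
  + move=> E; have [Au lu'] := lseen u lu ua; have [Av lv'] := lseen v lv va.
    have out x : s x <= a -> ~~ inside a b x by rewrite /inside; lia.
    by rewrite !agree ?out //; apply: glc => //; apply: rank_in_inj E.
  + by have := rkL u lu ua; lia.
  + by have := rkL v lv va; lia.
  + by move/addnI; apply: ixc; auto; rewrite ltnNge ?ua ?va.
- by move=> v rv; rewrite /gr'; case: ifP => vb; [have := rkR v rv vb; lia | lia].
- move=> u v ru rv; rewrite /gr'; case: ifP => ub; case: ifP => vb // E.
  + rewrite !right_keep //; have [Au ru'] := rseen u ru ub; have [Av rv'] := rseen v rv vb.
    by apply: grc => //; case: E; apply: rank_in_inj.
  + by have [-> _] := right_new u ru (negbT ub); have [-> _] := right_new v rv (negbT vb).
- move=> u v ru rv suv; rewrite /gr'; case: ifP => ub; case: ifP => vb // lt.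
  + have [_ ru'] := rseen u ru ub; have [_ rv'] := rseen v rv vb.
    apply: grh => //; case: (leqP (gr u) (gr v)) => le.
      by have /andP[_ +] := rank_in_diff AR le; lia.
    by have /andP[+ _] := rank_in_diff AR (ltnW le); lia.
  (* [u] is over the pillar and [v] is old, of rank at least one: then [v] was not
     in group [0] of the segment, where [u] is inside. *)
  + have [_ iu] := right_new u ru (negbT ub); have [_ rv'] := rseen v rv vb.
    apply: ltnW; apply: grf => //.
    have rk0 : rank_in AR 0 = 0 by rewrite /rank_in big_geq.
    by have /andP[_ +] := rank_in_diff AR (leq0n (gr v)); lia.
- by move=> u v iu rv; rewrite /gr'; case: ifP => // vb _; apply: floor.
Qed.

(** The segment is cut at the window ends from left to right.  After each cut
    the remaining part keeps the old right groups, while its left groups are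
    the old ones and one for each window already cut off; each window meets the
    bounds of the recursion by [grouped_window].  In the last part there is no
    old left neighbour, by the choice of [wf]. *)
Lemma extends_from_windows a b c :
    (forall a' b' c', a <= a' -> b' <= b -> b' - a' < b - a ->
       grouped a' b' c' -> extends a' b' c') ->
    grouped a b c -> (exists v, left_neighbor a b v) -> extends a b c.
Proof.
move=> IH [gl [gr [lg rg]]] [v0 /left_neighborP[w0 [va0 iw0 vw0]]].
have [glm gls glc] := lg; have [grm grc grh grf] := rg.
pose Q := [pred u | inside a b u && [exists v, (s v <= a) && adj v u]].
have Qw0 : Q w0 by rewrite /= iw0; apply/existsP; exists v0; rewrite va0.
case: (arg_maxnP s Qw0) => wf /andP[iw /existsP[kf /andP[ka kw]]] maxw.
set P := s wf in maxw.
have aP : a < P by case/andP: iw.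
have Pb : P < b by case/andP: iw => _; have := s_le_e wf; rewrite /P; lia.
(* The window from [q] to [r] is taken closed at [r] here, so that the open
   windows cut off by [greedy_windows] do not overflow. *)
pose over q r :=
  (8 * w <= \sum_(k < 14 * w - 1) left_seen a gl q r.+1 k) ||
  (8 * w <= \sum_(k < 8 * w) right_seen b gr q r.+1 k).
have [n [p [[p0 pn] inc no ov]]] := greedy_windows over aP.
have mono i j := @increasing_leq n p i j inc.
have n6 : n <= 6 * w.
  rewrite leqNgt; apply/negP => lt.
  have ap : a <= p 0 by rewrite p0.
  have pb : p (6 * w) < b by have := mono (6 * w) n (ltnW lt) (leqnn n); lia.
  have inc6 i : i < 6 * w -> p i < p i.+1 by move=> ?; apply: inc; lia.
  have [i lti small] := few_windows lg rg ap pb inc6.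
  by have := ov i; rewrite /over; lia.
have small i q : i < n -> q = p i.+1 ->
    (\sum_(g < 14 * w - 1) left_seen a gl (p i) q g < 8 * w) /\
    (\sum_(g < 8 * w) right_seen b gr (p i) q g < 8 * w).
  move=> iN ->{q}; have := inc i iN; case: (ltngtP (p i).+1 (p i.+1)) => // [lt|<-] _.
    have := no i (p i.+1).-1 iN; rewrite /over prednK; last by lia.
    lia.
  by split; rewrite big1 ?muln_gt0 ?w_gt0 // => g _; apply/eqP; rewrite eqb0;
     apply/negP => /existsP[v /existsP[u /and5P[_ _ ? ? _]]]; have := s_le_e u; lia.
have pb i : i <= n -> p i < b by move=> iN; have := mono i n iN (leqnn n); lia.
have pa i : i <= n -> a <= p i by move=> iN; have := mono 0 i isT iN; lia.
pose ix v := window_index p n (s v).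
have ixle v i : i <= n -> s v <= p i -> ix v <= i by exact: window_index_leq.
have ixgt v i : i < n -> p i < s v -> i < ix v.
  move=> iN; apply: window_index_gt => // j ji; apply: mono => //; exact: ltnW.
have ixmono u v : s u <= s v -> ix u <= ix v by exact: window_index_mono.
have out v : s v <= a -> ~~ inside a b v by rewrite /inside; lia.
have sub i v : i <= n -> inside (p i) b v -> inside a b v.
  by move=> iN; have := pa i iN; rewrite /inside; lia.
have left_sub i v : i <= n -> s v <= a -> left_neighbor (p i) b v -> left_neighbor a b v.
  move=> iN va /left_neighborP[u [_ iu vu]]; apply/left_neighborP; exists u; split=> //.
  exact: sub iu.
have right_sub i v : i <= n -> right_neighbor (p i) b v -> right_neighbor a b v.
  move=> iN /right_neighborP[u [vb iu vu]]; apply/right_neighborP; exists u; split=> //.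
  exact: sub iu.
have right_out v a' : right_neighbor a' b v -> ~~ inside a b v.
  by case/right_neighborP=> u [bv _ _]; rewrite /inside; lia.
have rgs i c' : i <= n -> (forall v, ~~ inside a b v -> c' v = c v) ->
    right_groups (p i) b c' (8 * w) gr.
  move=> iN agree; split.
  - by move=> v /(right_sub i _ iN)/grm.
  - move=> u v ru rv E; rewrite !agree ?(right_out _ _ ru) ?(right_out _ _ rv) //.
    by apply: grc => //; apply: (right_sub i).
  - by move=> u v ru rv; apply: grh; apply: (right_sub i).
  - by move=> u v iu rv; apply: grf; [apply: (sub i) | apply: (right_sub i)].
(* [m] is the number of windows still to be cut off. *)
suff peel m : forall i c', i + m = n -> (forall v, ~~ inside a b v -> c' v = c v) ->
    (forall u v, a < s u -> a < s v -> left_neighbor (p i) b u -> left_neighbor (p i) b v ->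
       ix u = ix v -> c' u = c' v) -> extends (p i) b c'.
  by rewrite -p0; apply: (peel n) => // u v; rewrite -p0 => au _ /andP[]; rewrite leqNgt au.
elim: m => [|m IHm] i c' imn agree ixc.
  rewrite addn0 in imn; subst i.
  have far v : left_neighbor (p n) b v -> a < s v.
    case/left_neighborP=> u [_ iu vu]; rewrite ltnNge; apply/negP => va.
    have Qu : Q u by rewrite /= (sub n) //; apply/existsP; exists v; rewrite va.
    by have := maxw u Qu; case/andP: iu; rewrite pn; lia.
  apply: IH => //; first by rewrite pn ltnW.
    by rewrite pn; lia.
  exists ix, gr; split; last exact: rgs.
  split.
  - by move=> v /left_neighborP[u [vp _ _]]; have := ixle v n (leqnn n) vp; lia.
  - by move=> u v _ _ lt; rewrite ltnNge; apply/negP => /ixmono; lia.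
  - by move=> u v lu lv; apply: ixc => //; apply: far.
have iN : i < n by lia.
pose gp v := if s v <= a then gl v else (14 * w - 1) + ix v.
have lgp : left_groups (p i) b c' (14 * w - 1 + i.+1) gp.
  split.
  - move=> v lv; rewrite /gp; case: ifP => va.
      by have := glm v (left_sub i v (ltnW iN) va lv); lia.
    by case/left_neighborP: lv => u [vp _ _]; have := ixle v i (ltnW iN) vp; lia.
  - move=> u v lu lv; rewrite /gp; case: ifP => ua; case: ifP => va; try lia.
    + by apply: gls; apply: (left_sub i) => //; exact: ltnW.
    + by have := glm v (left_sub i v (ltnW iN) va lv); lia.
    + by move=> lt; rewrite ltnNge; apply/negP => /ixmono; lia.
  - move=> u v lu lv; rewrite /gp; case: ifP => ua; case: ifP => va.
    + rewrite !agree ?out //; apply: glc; apply: (left_sub i) => //; exact: ltnW.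
    + by have := glm u (left_sub i u (ltnW iN) ua lu); lia.
    + by have := glm v (left_sub i v (ltnW iN) va lv); lia.
    + by move/addnI; apply: ixc; rewrite // ltnNge ?ua ?va.
have [|l lL fresh] := groups_fresh_label (L := 28 * w) _ lgp (rgs i c' (ltnW iN) agree).
  by lia.
have pi1 := inc i iN.
have [nL nR] := small i _ iN erefl.
apply: (extends_cut pi1 (pb _ iN) lL fresh).
  apply: IH; [exact: pa (ltnW iN) | exact: ltnW (pb _ iN) | |].
    by have := pa i (ltnW iN); have := pb _ iN; lia.
  apply: (grouped_window l lg rg (pa i (ltnW iN)) pi1 _ nL nR agree
    (ix := ix) (n := i.+1)) => //.
  - exists kf, wf; split=> //; by have := mono i.+1 n iN (leqnn n); rewrite pn.
  - by move=> v vp; rewrite ltnS; apply: ixle => //; exact: ltnW.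
  - by lia.
have rec_in v : left_neighbor (p i.+1) b v -> p i < s v ->
    recolor (p i) b (p i.+1) l c' v = l.
  case/left_neighborP=> u [vp iu vu] pv; rewrite /recolor /through /inside pv vp.
  have -> : e v < b by have := adj_finish vu; case/andP: iu => _; lia.
  by case/and3P: vu => _ uv _; case/andP: iu => ? _; rewrite (leq_trans _ uv) // ltnW.
have rec_out v : s v <= p i -> recolor (p i) b (p i.+1) l c' v = c' v.
  by move=> vp; rewrite /recolor /through /inside ltnNge vp.
have left_prev v : left_neighbor (p i.+1) b v -> s v <= p i -> left_neighbor (p i) b v.
  case/left_neighborP=> u [_ iu vu] vp; apply/left_neighborP; exists u; split=> //.
  by move: iu; rewrite /inside; lia.
apply: IHm; first by lia.
  move=> v nv; rewrite /recolor /through ifF ?agree //.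
  by apply/negP => /andP[/(sub i _ (ltnW iN))]; rewrite (negPf nv).
move=> u v au av lu lv E.
case: (leqP (s u) (p i)) => up; case: (leqP (s v) (p i)) => vp.
- by rewrite !rec_out //; apply: ixc => //; apply: left_prev.
- by have := ixle u i (ltnW iN) up; have := ixgt v i iN vp; lia.
- by have := ixle v i (ltnW iN) vp; have := ixgt u i iN up; lia.
- by rewrite !rec_in.
Qed.

(** Without left neighbours, the pillar at the first finish of an inside element
    leaves nothing inside the part before it, and in the part after it all left
    neighbours pass over the pillar and form a single group. *)
Lemma extends_grouped k : forall a b c, b - a < k -> grouped a b c -> extends a b c.
Proof.
elim: k => // k IH a b c bak st.
case: (boolP [exists v, left_neighbor a b v]) => [/existsP ex | no].
  apply: extends_from_windows => // a' b' c' aa' bb' lt st'; apply: IH => //; lia.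
case: (boolP [exists v, inside a b v]); last first.
  by rewrite negb_exists => /forallP ni; apply: extends_empty.
case/existsP=> v0 iv0.
case: (arg_minnP e iv0) => vm im minm.
have [gl [gr [_ rg]]] := st; have [grm grc grh grf] := rg.
have nol v : left_neighbor a b v = false.
  by apply/negbTE; move: no; rewrite negb_exists => /forallP.
have lg : left_groups a b c 0 gl by split=> [v|u v|u v]; rewrite nol.
have [l lL fresh] := groups_fresh_label (ltac:(lia) : 0 + 8 * w < 28 * w) lg rg.
have [? ?] : a < e vm /\ e vm < b by case/andP: im => *; split=> //; have := s_le_e vm; lia.
apply: (extends_cut (p := e vm) _ _ lL fresh) => //.
  apply: extends_empty => v; apply/negP; rewrite /inside => /andP[av ev].
  have iv : inside a b v by rewrite /inside; lia.
  by have := minm v iv; lia.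
have sub v : inside (e vm) b v -> inside a b v by rewrite /inside; lia.
have rsub v : right_neighbor (e vm) b v -> right_neighbor a b v.
  case/right_neighborP=> u [vb iu vu]; apply/right_neighborP; exists u; split=> //; exact: sub.
have rec_r v : right_neighbor (e vm) b v -> recolor a b (e vm) l c v = c v.
  case/right_neighborP=> u [bv _ _]; rewrite /recolor /through /inside.
  by rewrite [e v < b]ltnNge bv andbF.
have rec_l v : left_neighbor (e vm) b v -> recolor a b (e vm) l c v = l.
  move=> lv; case/left_neighborP: (lv) => u [vp iu vu].
  have av : a < s v.
    rewrite ltnNge; apply/negP => va; have := nol v => /negP[]; apply/left_neighborP.
    by exists u; split=> //; exact: sub.
  rewrite /recolor /through /inside av vp.
  have -> : e v < b by have := adj_finish vu; case/andP: iu => _; lia.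
  by case/and3P: vu => _ uv _; case/andP: iu => ? _; rewrite (leq_trans _ uv) // ltnW.
apply: IH; first by lia.
exists (fun=> 0), gr; split; split.
- by move=> *; lia.
- by [].
- by move=> u v lu lv _; rewrite !rec_l.
- by move=> v /rsub/grm.
- by move=> u v ru rv; rewrite !rec_r //; apply: grc; apply: rsub.
- by move=> u v ru rv; apply: grh; apply: rsub.
- by move=> u v iu rv; apply: grf; [apply: sub | apply: rsub].
Qed.

End Segments.

(** * From segments to graphs *)

Lemma nested_family_coloring (T : finType) (s e h : T -> nat) w :
    (forall v, 0 < s v) -> (forall v, s v <= e v) ->
    nested_lower s e h -> clique_bound s e h w -> 0 < w ->
  exists lab lev : T -> nat,
    (forall v, (lab v < 28 * w) && (lev v < w)) /\
    (forall u v, adj s e h u v -> (lab u, lev u) <> (lab v, lev v)).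
Proof.
move=> s0 se ne cb w0; pose b := (\max_v e v).+1.
have inb v : inside s e 0 b v by rewrite /inside s0 ltnS leq_bigmax.
have st : grouped s e h w 0 b (fun=> 0).
  have nol v : left_neighbor s e h 0 b v = false.
    by rewrite /left_neighbor leqNgt s0.
  have nor v : right_neighbor s e h 0 b v = false.
    by have /andP[_] := inb v; rewrite /right_neighbor ltnNge => /negPf ->.
  exists (fun=> 0), (fun=> 0); split; first by split=> [v|u v|u v]; rewrite nol.
  by split=> [v|u v|u v|u v _]; rewrite nor.
have [lab [lev [lt pr _]]] := extends_grouped se ne cb w0 (ltnSn _) st.
by exists lab, lev; split=> [v | u v]; [apply: lt | apply: pr].
Qed.

(** The first use of Mirsky's theorem: among elements of equal Mirsky height
    for the order of being nested and not lower, nested elements are lower. *)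
Lemma family_coloring (T : finType) (s e h : T -> nat) w :
    (forall v, 0 < s v) -> (forall v, s v <= e v) ->
    clique_bound s e h w -> 0 < w ->
  exists col : T -> 'I_w * 'I_(28 * w) * 'I_w,
    forall u v, adj s e h u v -> col u <> col v.
Proof.
move=> s0 se cb w0.
pose r u v := [&& s u < s v, e v <= e u & h u <= h v].
have [|||f [fw fr]] := @mirsky T r w.
- by move=> v; rewrite /r ltnn.
- by move=> v u x /and3P[? ? ?] /and3P[? ? ?]; rewrite /r; lia.
- move=> A cA; apply: cb => u v uA vA nuv; rewrite /adj.
  by have := se u; have := se v; have := cA u v uA vA nuv; rewrite /r; lia.
have cls (k : 'I_w) : exists lab lev : T -> nat,
    (forall v, (lab v < 28 * w) && (lev v < w)) /\
    (forall u v, f u = k -> f v = k -> adj s e h u v ->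
       (lab u, lev u) <> (lab v, lev v)).
  pose S := {v : T | f v == k}.
  have [|||||lab [lev [lt pr]]] :=
    @nested_family_coloring S (s \o val) (e \o val) (h \o val) w.
  - by move=> v; apply: s0.
  - by move=> v; apply: se.
  - move=> u v /= suv euv; rewrite ltnNge; apply/negP => huv.
    have := fr (val u) (val v); rewrite /r suv euv huv => /(_ isT).
    by rewrite (eqP (valP u)) (eqP (valP v)) ltnn.
  - move=> A cA; rewrite -(card_imset _ val_inj); apply: cb.
    move=> _ _ /imsetP[u uA ->] /imsetP[v vA ->] nuv; apply: (cA u v uA vA).
    by apply: contraNneq nuv => ->.
  - exact: w0.
  exists (fun v => oapp lab 0 (insub v)), (fun v => oapp lev 0 (insub v)); split.
    by move=> v; case: insubP => [x _ _|_] /=; [apply: lt | lia].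
  move=> u v /eqP fu /eqP fv uv.
  by rewrite (insubT (fun v => f v == k) fu) (insubT (fun v => f v == k) fv); apply: pr.
have [lab labP] := fin_all_exists cls.
have [lev levP] := fin_all_exists labP.
pose k v := Ordinal (fw v).
have lt1 v : lab (k v) v < 28 * w by have [/(_ v)/andP[]] := levP (k v).
have lt2 v : lev (k v) v < w by have [/(_ v)/andP[]] := levP (k v).
exists (fun v => (k v, Ordinal (lt1 v), Ordinal (lt2 v))) => u v uv [ek el ev].
have [_ pr] := levP (k v); apply: (pr u v ek erefl uv).
have kk : k u = k v by apply: val_inj.
by move: el ev; rewrite kk => -> ->.
Qed.

Lemma colorable_by (G : sgraph) (C : finType) (c : G -> C) k :
  #|C| <= k -> (forall x y, edge x y -> c x <> c y) -> colorable G k.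
Proof.
move=> Ck pr; apply/existsP; exists [ffun x => widen_ord Ck (enum_rank (c x))].
apply/forallP => x; apply/forallP => y; apply/implyP => exy.
rewrite !ffunE; apply/eqP => /(congr1 val) /= /val_inj /enum_rank_inj.
exact: pr.
Qed.

Lemma chromatic_number_leq (G : sgraph) k : colorable G k -> chromatic_number G <= k.
Proof. by rewrite /chromatic_number; case: ex_minnP => m _ min /min. Qed.

Lemma clique_number_geq (G : sgraph) (K : {set G}) :
  {in K &, forall u v, u != v -> edge u v} -> #|K| <= clique_number G.
Proof.
move=> cK; apply: leq_bigmax_cond; apply/forall_inP => u uK; apply/forall_inP => v vK.
by apply/implyP; apply: cK.
Qed.

Lemma edgeless_coloring (G : sgraph) :
  clique_number G <= 1 -> colorable G (clique_number G).
Proof.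
move=> w1.
have pos (v : G) : 0 < clique_number G.
  rewrite -(cards1 v); apply: clique_number_geq => x y.
  by rewrite !inE => /eqP -> /eqP ->; rewrite eqxx.
apply: (@colorable_by G _ (fun v => Ordinal (pos v))); first by rewrite card_ord.
move=> x y exy _; have nxy : x != y by apply: contraTneq exy => ->; rewrite edge_irrefl.
have : #|[set x; y]| <= clique_number G.
  apply: clique_number_geq => u v.
  rewrite !inE => /orP[] /eqP -> /orP[] /eqP ->; rewrite ?eqxx // => _ //.
  by rewrite edge_sym.
by rewrite cards2 nxy; lia.
Qed.

Lemma graph_coloring (G : sgraph) (s e h : G -> nat) :
    (forall v, 0 < s v) -> (forall v, s v <= e v) ->
    (forall u v : G, edge u v = adj s e h u v || adj s e h v u) ->
  chromatic_number G <= 17 * clique_number G ^ 4.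
Proof.
move=> s0 se edgeE; set w := clique_number G.
case: (leqP w 1) => w1.
  apply: leq_trans (chromatic_number_leq (edgeless_coloring w1)) _.
  by rewrite -/w; case: w w1 => [|[|]].
have cb : clique_bound s e h w.
  move=> A cA; apply: clique_number_geq => u v uA vA nuv.
  by rewrite edgeE; apply: cA.
have [col colP] := family_coloring s0 se cb (ltnW w1).
apply: chromatic_number_leq; apply: (colorable_by (c := col)).
  rewrite !card_prod !card_ord !expnS expn0; nia.
move=> x y; rewrite edgeE => /orP[/colP //|/colP xy /esym]; exact: xy.
Qed.

(** * L-shapes and their ranks *)

Section Geometry.
Variable R : realType.
Local Open Scope classical_set_scope.
Local Open Scope ring_scope.
Import Order.TTheory GRing.Theory Num.Theory.

Definition L_set (x y r : R) : set (R * R) :=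
  vertical_segment x 0 y `|` horizontal_segment x r y.

Lemma grounded_L_shapeP (A : set (R * R)) : grounded_L_shape A ->
  exists x y r, [/\ 0 < y, x < r & A = L_set x y r].
Proof.
move=> [[x [y0 [r [y [y0y xr ->]]]]] [p [Ap low] p0]].
exists x, y, r; rewrite /L_set.
suff <- : y0 = 0 by split.
apply/eqP; rewrite eq_le; apply/andP; split.
  case: Ap => [[_ /andP[+ _]]|[_ py]]; first by rewrite p0.
  by rewrite -p0 py ltW.
rewrite -p0; apply: (low (x, y0)); left; split => //=.
by rewrite lexx ltW.
Qed.

(** If the L-shapes meet at all, then also on the horizontal segment of the
    first and the vertical segment of the second.  For this, the lower one has
    to count as first when both start at the same abscissa. *)
Lemma L_set_meet x1 y1 r1 x2 y2 r2 :
    0 < y1 -> x1 < r1 -> 0 < y2 -> x2 < r2 ->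
    x1 < x2 \/ x1 = x2 /\ y1 <= y2 ->
  (L_set x1 y1 r1 `&` L_set x2 y2 r2 !=set0) <-> (x2 <= r1) && (y1 <= y2).
Proof.
move=> y10 xr1 y20 xr2 ord.
have x12 : x1 <= x2 by case: ord => [/ltW //|[-> _]].
split; last first.
  case/andP=> x2r1 y12; exists (x2, y1); split; [right | left]; split=> //=.
    by rewrite x12.
  by rewrite ltW.
case=> -[a b] [H1 H2].
have xa : x2 <= a by case: H2 => [[/= -> _]|[/= /andP[]]].
have b2 : b <= y2 by case: H2 => [[_ /= /andP[]]|[_ /= ->]].
case: H1 => [[/= ax /andP[_ by1]]|[/= /andP[_ ar] <-]].
  case: ord => [lt|[<- ->]]; last by rewrite ltW.
  by move: xa; rewrite ax leNgt lt.
by rewrite b2 (le_trans xa).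
Qed.

End Geometry.

Section Discretize.
Variable R : realType.
Local Open Scope ring_scope.
Import Order.TTheory GRing.Theory Num.Theory.
Variables (T : finType) (x y r : T -> R).
Hypothesis x_lt_r : forall v, x v < r v.

(** Vertical segments at the same abscissa are ordered by height, to agree with
    the convention for meeting, and remaining ties are broken by an arbitrary
    enumeration, to have distinct starts. *)
Definition before (u v : T) := (x u < x v) || (x u == x v) &&
  ((y u < y v) || (y u == y v) && (enum_rank u < enum_rank v)%N).

(** Starts are counted from one, so that all L-shapes are inside the segment
    from [0]; [finish v] is then the last start that [v] reaches. *)
Definition start v := #|[set u | before u v]|.+1.
Definition finish v := #|[set u | x u <= r v]|.
Definition height v := #|[set u | y u < y v]|.

Lemma before_irrefl : irreflexive before.
Proof. by move=> v; rewrite /before !ltxx ltnn !andbF. Qed.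

Lemma before_trans : transitive before.
Proof.
move=> v u t /orP[uv|/andP[/eqP uv uv']] /orP[vt|/andP[/eqP vt vt']].
- by rewrite /before (lt_trans uv vt).
- by rewrite /before -vt uv.
- by rewrite /before uv vt.
rewrite /before uv vt ltxx eqxx /=.
move: uv' vt' => /orP[uv'|/andP[/eqP uv' uv2]] /orP[vt'|/andP[/eqP vt' vt2]].
- by rewrite (lt_trans uv' vt').
- by rewrite -vt' uv'.
- by rewrite uv' vt'.
by rewrite uv' vt' ltxx eqxx /= (ltn_trans uv2 vt2).
Qed.

Lemma before_total u v : u != v -> before u v || before v u.
Proof.
move=> nuv; rewrite /before [x v == _]eq_sym [y v == _]eq_sym.
case: (ltgtP (x u) (x v)) => //= _; case: (ltgtP (y u) (y v)) => //= _.
by rewrite -neq_ltn (inj_eq val_inj) (inj_eq enum_rank_inj).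
Qed.

Lemma before_start u v : before u v -> (start u < start v)%N.
Proof.
move=> uv; rewrite ltnS; apply: proper_card; apply/fintype.properP; split.
  by apply/fintype.subsetP => t; rewrite !inE => tu; apply: before_trans uv.
by exists u; rewrite !inE ?before_irrefl.
Qed.

Lemma start_before u v : (start u < start v)%N = before u v.
Proof.
apply/idP/idP; last exact: before_start.
have [->|/before_total/orP[//|/before_start]] := eqVneq u v; first by rewrite ltnn.
by move=> vu uv; have := ltn_trans uv vu; rewrite ltnn.
Qed.

Lemma start_finish u v : (start u <= finish v)%N = (x u <= r v).
Proof.
have le t t' : before t t' -> x t <= x t'.
  by case/orP => [/ltW //|/andP[/eqP -> _]].
apply/idP/idP => [|ur].
  apply: contraTT; rewrite -ltNge -ltnNge => ru; rewrite ltnS; apply: subset_leq_card.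
  apply/fintype.subsetP => t; rewrite !inE => tr.
  by rewrite /before (le_lt_trans tr ru).
have -> : start u = #|u |: [set t | before t u]|.
  by rewrite cardsU1 inE before_irrefl.
apply: subset_leq_card; apply/fintype.subsetP => t; rewrite !inE.
by case/orP=> [/eqP -> //|/le tu]; apply: le_trans ur.
Qed.

Lemma height_leq u v : (height u <= height v)%N = (y u <= y v).
Proof.
apply/idP/idP => [|uv]; last first.
  by apply: subset_leq_card; apply/fintype.subsetP => t; rewrite !inE => tu; apply: lt_le_trans uv.
apply: contraTT; rewrite -ltNge -ltnNge => vu; apply: proper_card; apply/fintype.properP; split.
  by apply/fintype.subsetP => t; rewrite !inE => tv; apply: lt_trans vu.
by exists v; rewrite !inE ?ltxx.
Qed.

Lemma start_leq_finish v : (start v <= finish v)%N.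
Proof. by rewrite start_finish ltW. Qed.
End Discretize.

Theorem theorem1 (R : realType) (G : sgraph) (hG : grounded_L_graph R G) :
  chromatic_number G <= 17 * clique_number G ^ 4.
Proof.
case: hG => I [F [shape [f /bij_inj injf fE]]].
have [x xP] := fin_all_exists (fun v => grounded_L_shapeP (shape (f v))).
have [y yP] := fin_all_exists xP.
have [r rP] := fin_all_exists yP.
have xr v : (x v < r v)%R by case: (rP v).
apply: (@graph_coloring G (start x y) (finish x r) (height y)) => //.
  by move=> v; apply: start_leq_finish.
have meetE u v : before x y u v ->
    edge u v = adj (start x y) (finish x r) (height y) u v.
  move=> uv; rewrite -fE /= /Defs.meets.
  have -> : f u == f v = false.
    by apply: contraTF uv => /eqP/injf ->; rewrite before_irrefl.
  rewrite /adj start_before uv start_finish height_leq /=.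
  have [yu xu ->] := rP u; have [yv xv ->] := rP v.
  have [|meet1 meet2] := @L_set_meet _ _ _ _ _ _ _ yu xu yv xv.
    case/orP: uv => [->|/andP[/eqP -> yuv]]; [by left | right; split=> //].
    case/orP: yuv => [/Order.POrderTheory.ltW //|/andP[/eqP -> _]].
    exact: Order.POrderTheory.lexx.
  by apply/asboolP/idP.
have anti u v : before x y u v -> adj (start x y) (finish x r) (height y) v u = false.
  by move=> uv; rewrite /adj start_before; apply/negbTE; apply/negP => /and3P[vu _ _];
     have := before_trans uv vu; rewrite before_irrefl.
move=> u v; have [->|/(before_total x y)/orP[uv|vu]] := eqVneq u v.
- by rewrite edge_irrefl /adj ltnn.
- by rewrite (meetE _ _ uv) (anti _ _ uv) orbF.
- by rewrite edge_sym (meetE _ _ vu) (anti _ _ vu).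
Qed.
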